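(* Let $H$ be a $d$-degenerate bipartite graph with $n$ vertices and maximum degree $\Delta$. Let $\epsilon>0$ and let $G=(V_1,V_2;E)$ be a bipartite graph with $|V_1|=|V_2|=N$ and at least $\epsilon N^2$ edges. Suppose $d \geq 2$, $d/n \leq \delta \leq 1$, and let $x=2^{-9}\epsilon^{\left(1+(1+\delta^{-1})d\right)(1+\delta)}\Delta^{-\delta}N$. If $x \geq 4n$, then $G$ contains at least $(x/4)^n$ labeled copies of $H$.
   Context: A graph is $d$-degenerate if every subgraph of it has a vertex of degree at most $d$. $G=(V_1,V_2;E)$ denotes a bipartite graph with parts $V_1,V_2$. A labeled copy of $H$ in $G$ is an injective map from the vertex set of $H$ to the vertex set of $G$ mapping edges of $H$ to edges of $G$. *)

(* Defs.v *)
From mathcomp Require Import all_boot.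

Set Implicit Arguments.
Unset Strict Implicit.
Unset Printing Implicit Defensive.

Record sgraph := SGraph {
  vertex :> finType;
  adj : rel vertex;
  adj_sym : symmetric adj;
  adj_irr : irreflexive adj }.

Definition edges (G : sgraph) : {set {set G}} :=
  [set A : {set G} |
    [exists u : G, exists v : G, adj u v && (A == [set u; v])]].

Definition degree (G : sgraph) (v : G) : nat := #|[set u : G | adj v u]|.

Definition max_degree (G : sgraph) : nat := \max_(v : G) degree v.

(* [(S, e)] is a subgraph, not necessarily induced. *)
Definition is_subgraph (G : sgraph) (S : {set G}) (e : rel G) : Prop :=
  symmetric e /\
  forall u v : G, e u v -> [/\ u \in S, v \in S & adj u v].

(* The subgraph without vertices is excluded: it has no vertex at all. *)
Definition degenerate (d : nat) (G : sgraph) : Prop :=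
  forall (S : {set G}) (e : rel G), is_subgraph S e -> S != set0 ->
  exists2 v : G, v \in S & #|[set u : G | e v u]| <= d.

Definition bipartition (G : sgraph) (V1 V2 : {set G}) : Prop :=
  [/\ V1 :|: V2 = [set: G], [disjoint V1 & V2] &
      forall u v : G, adj u v ->
        (u \in V1 /\ v \in V2) \/ (u \in V2 /\ v \in V1)].

Definition bipartite (G : sgraph) : Prop :=
  exists V1 V2 : {set G}, bipartition V1 V2.

Definition labeled_copies (H G : sgraph) : {set {ffun H -> G}} :=
  [set f : {ffun H -> G} |
    injectiveb f && [forall u : H, forall v : H, adj u v ==> adj (f u) (f v)]].

(* Main.v *)
(** Dependent random choice with a random complete bipartite pair.  Put
[t = d + k] with [d / delta <= k <= d / delta + 1], and choose [s] in [V1^t] and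
[u] in [V2^t] uniformly among the pairs spanning a complete bipartite graph; by
convexity there are at least [eps^(t^2) N^(2t)] of them.  Let [A] and [B] be the
common neighbourhoods of [u] in [V1] and of [s] in [V2].  If [r] is a [d]-tuple
of [A] with fewer than [x] common neighbours in [B], then [u] lies in the common
neighbourhood of [r ++ s], of size less than [x]; hence at most
[N^(t+d) x^t] triples [(s, u, r)] are bad, and the same holds for [B].
The value of [x] is such that for some pair the bad tuples of [A] and
those of [B] number less than [y^d] with [y = x / (128 Delta)], while [A] and [B]
have at least [x] elements.

[H] is then embedded greedily along a degenerate order, keeping for each future
vertex the images of its embedded neighbours extendable to few bad tuples: when
[j] more neighbours are to come, fewer than [y^j] extensions are bad.  Each of
the at most [Delta] future neighbours of the current vertex forbids fewer than
[y] of its at least [x] candidates, and at most [n <= x / 4] are already used. *)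

Require Import Defs.
From mathcomp Require Import all_boot all_order all_algebra.
From mathcomp Require Import reals exp.
From mathcomp Require Import lra ring.

Set Implicit Arguments.
Unset Strict Implicit.
Unset Printing Implicit Defensive.

Import Order.TTheory GRing.Theory Num.Theory.

Local Open Scope ring_scope.

(** * Sums over tuples *)

Section TupleSum.
Variables (R : realFieldType) (T : finType).
Implicit Types (X Y : {set T}) (F : seq T -> R) (s u : seq T).

(* The sum of [F] over [X^k], tuples being represented by sequences. *)
Fixpoint tsum X (k : nat) F : R :=
  if k is k'.+1 then \sum_(v in X) tsum X k' (fun s => F (v :: s)) else F [::].

Lemma tsumS X k F :
  tsum X k.+1 F = \sum_(v in X) tsum X k (fun s => F (v :: s)).
Proof. by []. Qed.

Lemma ler_tsum X k F F' :
  (forall s, all (mem X) s -> size s = k -> F s <= F' s) ->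
  tsum X k F <= tsum X k F'.
Proof.
elim: k F F' => [|k IH] F F' leF /=; first exact: leF.
apply: ler_sum => v vX; apply: IH => s sX sk.
by apply: leF; rewrite /= ?sk // vX.
Qed.

Lemma eq_tsum X k F F' : (forall s, F s = F' s) -> tsum X k F = tsum X k F'.
Proof.
elim: k F F' => [|k IH] F F' eqF /=; first exact: eqF.
by apply: eq_bigr => v _; apply: IH.
Qed.

Lemma tsumD X k F F' :
  tsum X k (fun s => F s + F' s) = tsum X k F + tsum X k F'.
Proof.
elim: k F F' => [|k IH] F F' //=.
by rewrite -big_split; apply: eq_bigr => v _; rewrite IH.
Qed.

Lemma tsumZ X k c F : tsum X k (fun s => c * F s) = c * tsum X k F.
Proof.
elim: k F => [|k IH] F //=.
by rewrite mulr_sumr; apply: eq_bigr => v _; rewrite IH.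
Qed.

Lemma tsum_const X k c : tsum X k (fun=> c) = #|X|%:R ^+ k * c.
Proof.
elim: k => [|k IH] /=; first by rewrite mul1r.
by rewrite IH sumr_const exprS -mulrA mulr_natl.
Qed.

Lemma tsum_sum X k (I : finType) (A : {set I}) (F : I -> seq T -> R) :
  tsum X k (fun s => \sum_(i in A) F i s) = \sum_(i in A) tsum X k (F i).
Proof.
elim: k F => [|k IH] F //=.
by under eq_bigr do rewrite IH; rewrite exchange_big.
Qed.

Lemma tsum_exchange X Y k l (F : seq T -> seq T -> R) :
  tsum X k (fun s => tsum Y l (F s)) =
  tsum Y l (fun u => tsum X k (fun s => F s u)).
Proof.
elim: k F => [|k IH] F //=.
by rewrite tsum_sum; apply: eq_bigr => v _; rewrite IH.
Qed.

Lemma natr_card_sep X (p : pred T) :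
  #|[set v in X | p v]|%:R = \sum_(v in X) (p v)%:R :> R.
Proof.
rewrite -sum1_card natr_sum (eq_bigl (fun v => (v \in X) && p v)).
  by rewrite big_mkcondr; apply: eq_bigr => v _; case: (p v).
by move=> v; rewrite inE.
Qed.

Lemma tsum_pow X k (p : T -> bool) :
  tsum X k (fun s => (all p s)%:R) = #|[set v in X | p v]|%:R ^+ k.
Proof.
elim: k => [|k IH] //=.
rewrite exprS natr_card_sep mulr_suml; apply: eq_bigr => v _.
rewrite -natr_card_sep; case: (p v) => /=; first by rewrite IH mul1r.
by rewrite tsum_const mulr0 mul0r.
Qed.

Lemma tsum_sub X k F (p : pred T) :
  tsum [set v in X | p v] k F = tsum X k (fun s => (all p s)%:R * F s).
Proof.
elim: k F => [|k IH] F /=; first by rewrite mul1r.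
rewrite [LHS](eq_bigl (fun v => (v \in X) && p v)); last first.
  by move=> v; rewrite inE.
rewrite big_mkcondr; apply: eq_bigr => v _.
case: (p v) => /=; first by rewrite IH.
rewrite (@eq_tsum _ _ _ (fun=> 0)) ?tsum_const ?mulr0 // => s.
by rewrite mul0r.
Qed.

End TupleSum.

(** * Convexity of powers *)

Section PowerMean.
Variable R : realFieldType.

(** The left side is the tangent at [M] to the power [m.+1]. In the induction, [z] times the tangent
    for [m] exceeds the next one by [M ^+ m * (m.+1%:R * (z - M) ^+ 2)]. *)
Lemma exprS_ge_tangent (z M : R) m : 0 <= z -> 0 <= M ->
  M ^+ m * (m.+1%:R * z - m%:R * M) <= z ^+ m.+1.
Proof.
move=> z0 M0; elim: m => [|m IH]; first by rewrite expr1 expr0; lra.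
rewrite [leRHS]exprS; apply: le_trans (ler_wpM2l z0 IH).
rewrite -subr_ge0.
have -> : z * (M ^+ m * (m.+1%:R * z - m%:R * M)) -
   M ^+ m.+1 * (m.+2%:R * z - m.+1%:R * M) = M ^+ m * (m.+1%:R * (z - M) ^+ 2).
  rewrite exprS -[m.+2]addn2 -[m.+1]addn1 !natrD; ring.
by rewrite mulr_ge0 ?exprn_ge0 // mulr_ge0 ?ler0n ?sqr_ge0.
Qed.

(** Sum the tangent inequality at [M], which may be any nonnegative lower bound on the mean. *)
Lemma power_mean_tsum (T : finType) (X : {set T}) k m (F : seq T -> R) (M : R) :
  0 <= M -> (forall s, 0 <= F s) -> M * #|X|%:R ^+ k <= tsum X k F ->
  M ^+ m * #|X|%:R ^+ k <= tsum X k (fun s => F s ^+ m).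
Proof.
move=> M0 F0 leM; case: m => [|m]; first by rewrite !expr0 tsum_const mulr1 mul1r.
pose L s := M ^+ m * m.+1%:R * F s + - (M ^+ m * m%:R * M).
apply: (@le_trans _ _ (tsum X k L)).
  rewrite /L tsumD tsumZ tsum_const.
  have /(ler_wpM2l (_ : 0 <= M ^+ m * m.+1%:R)) := leM.
  rewrite mulr_ge0 ?exprn_ge0 ?ler0n // => /(_ isT).
  rewrite exprS -[m.+1]addn1 natrD; lra.
apply: ler_tsum => s _ _; apply: le_trans (exprS_ge_tangent m (F0 s) M0).
by rewrite /L; rewrite le_eqVlt; apply/orP; left; apply/eqP; ring.
Qed.

Lemma power_mean_sum (T : finType) (X : {set T}) m (f : T -> R) (M : R) :
  0 <= M -> (forall v, 0 <= f v) -> M * #|X|%:R <= \sum_(v in X) f v ->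
  M ^+ m * #|X|%:R <= \sum_(v in X) f v ^+ m.
Proof.
case: (set_0Vmem X) => [->|[x0 _]] M0 f0; first by rewrite cards0 !mulr0 !big_set0.
by apply: (@power_mean_tsum _ X 1 m (fun s => f (head x0 s)) M).
Qed.

End PowerMean.

(** * Dependent random choice *)

Section RandomChoice.
Variables (R : realFieldType) (T : finType) (e : rel T).
Hypothesis esym : symmetric e.
Implicit Types (X Y : {set T}) (s u : seq T).

Definition cnbr Y s : {set T} := [set v in Y | all (e v) s].

Lemma cnbr_cat Y s u : cnbr Y (s ++ u) = cnbr (cnbr Y u) s.
Proof. by apply/setP=> v; rewrite !inE all_cat andbA andbAC. Qed.

Lemma tsum_allrel Y k s :
  tsum Y k (fun u => (allrel e u s)%:R) = #|cnbr Y s|%:R ^+ k :> R.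
Proof. by rewrite -tsum_pow; apply: eq_tsum. Qed.

Lemma allrel_sym s u : allrel e s u = allrel e u s.
Proof. by rewrite allrelC; apply: eq_allrel => a b; rewrite esym. Qed.

(** Convexity is used twice: over [v] in [Y], with mean degree at least [eps * n], the [t]-th powers
    of degrees counting tuples of [X^t] with a common neighbour [v]; then over these tuples, with
    mean at least [eps ^+ t * n]. *)
Lemma bicliques_ge X Y (n : nat) (eps : R) t : 0 <= eps -> #|X| = n -> #|Y| = n ->
  eps * n%:R ^+ 2 <= \sum_(v in Y) #|cnbr X [:: v]|%:R ->
  eps ^+ (t * t) * n%:R ^+ (2 * t) <=
    tsum X t (fun s => tsum Y t (fun u => (allrel e s u)%:R)).
Proof.
move=> eps0 cX cY le_e.
have step1 : (eps ^+ t * n%:R) * #|X|%:R ^+ t <= tsum X t (fun s => #|cnbr Y s|%:R).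
  have -> : tsum X t (fun s => #|cnbr Y s|%:R) =
      \sum_(v in Y) #|cnbr X [:: v]|%:R ^+ t :> R.
    under [RHS]eq_bigr do rewrite -tsum_pow.
    rewrite -tsum_sum; apply: eq_tsum => s.
    rewrite natr_card_sep; apply: eq_bigr => v _.
    by congr (_ : bool)%:R; apply: eq_all => a /=; rewrite andbT esym.
  have := @power_mean_sum R T Y t (fun v => #|cnbr X [:: v]|%:R) (eps * n%:R).
  rewrite cX cY -mulrA -expr2 mulr_ge0 ?ler0n // => /(_ isT) /(_ (fun=> ler0n _ _)) /(_ le_e).
  by apply: le_trans; rewrite le_eqVlt; apply/orP; left; apply/eqP; rewrite exprMn; ring.
have := @power_mean_tsum R T X t t _ _ _ _ step1.
rewrite cX mulr_ge0 ?exprn_ge0 ?ler0n // => /(_ isT) /(_ (fun=> ler0n _ _)) h.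
apply: le_trans (le_trans h _).
  by rewrite le_eqVlt; apply/orP; left; apply/eqP;
    rewrite exprMn exprM mul2n -addnn exprD mulrA.
apply: ler_tsum => s _ _; rewrite -tsum_allrel le_eqVlt;
  apply/orP; left; apply/eqP/eq_tsum => u.
by rewrite allrel_sym.
Qed.

Definition sparse (x : R) Y s : bool := #|cnbr Y s|%:R < x.

(** For fixed [s] and [r], the tuples [u] complete to both are those of the common neighbourhood of
    [r ++ s]: at most [x ^+ t] of them when [r] is sparse. *)
Lemma sparse_tuples_total X Y (x : R) d t : 0 <= x ->
  tsum X t (fun s => tsum Y t (fun u => (allrel e s u)%:R *
     tsum (cnbr X u) d (fun r => (sparse x (cnbr Y s) r)%:R)))
  <= #|X|%:R ^+ (t + d) * x ^+ t.
Proof.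
move=> x0; rewrite exprD -mulrA -tsum_const; apply: ler_tsum => s _ _.
rewrite -tsum_const.
under eq_tsum => u do rewrite tsum_sub -tsumZ.
rewrite tsum_exchange; apply: ler_tsum => r _ _.
rewrite (@eq_tsum _ _ _ _ _ (fun u =>
  (sparse x (cnbr Y s) r)%:R * (allrel e u (r ++ s))%:R)).
  rewrite tsumZ tsum_allrel cnbr_cat /sparse.
  case: ltP => [lx|_]; last by rewrite mul0r exprn_ge0.
  by rewrite mul1r lerXn2r ?nnegrE ?ler0n // ltW.
move=> u; rewrite mulrA [RHS]mulrC; congr (_ * _).
by rewrite allrel_catr -natrM mulnb andbC ![allrel e u _]allrel_sym.
Qed.

Lemma small_cnbr_total X Y (x c : R) t : 0 <= x -> 0 <= c ->
  tsum X t (fun s => tsum Y t (fun u => (allrel e s u)%:R *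
     ((sparse x X u)%:R * c)))
  <= #|Y|%:R ^+ t * (x ^+ t * c).
Proof.
move=> x0 c0; rewrite tsum_exchange -tsum_const; apply: ler_tsum => u _ _.
rewrite (@eq_tsum _ _ _ _ _ (fun s =>
  ((sparse x X u)%:R * c) * (allrel e s u)%:R)); last by move=> s; rewrite mulrC.
rewrite tsumZ tsum_allrel /sparse.
case: ltP => [lx|_]; last by rewrite !mul0r mulr_ge0 ?exprn_ge0.
by rewrite mul1r mulrC ler_wpM2r // lerXn2r ?nnegrE ?ler0n // ltW.
Qed.

(** First moment: if every complete pair had total penalty at least [y ^+ d], the lower bound on the
    number of pairs would contradict the last inequality, whose factor 3 covers the three
    penalties. *)
Lemma dependent_random_choice X Y (n d t : nat) (eps x y : R) :
  0 <= eps -> 0 < x -> x <= n%:R -> 0 < y -> y <= x -> #|X| = n -> #|Y| = n ->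
  eps * n%:R ^+ 2 <= \sum_(v in Y) #|cnbr X [:: v]|%:R ->
  3 * (n%:R ^+ (t + d) * x ^+ t) < y ^+ d * (eps ^+ (t * t) * n%:R ^+ (2 * t)) ->
  exists A B : {set T}, [/\ A \subset X, B \subset Y, x <= #|A|%:R, x <= #|B|%:R &
    tsum A d (fun r => (sparse x B r)%:R) < y ^+ d /\
    tsum B d (fun r => (sparse x A r)%:R) < y ^+ d].
Proof.
move=> eps0 x0 xn y0 yx cX cY le_e small.
pose bad s u : R := tsum (cnbr X u) d (fun r => (sparse x (cnbr Y s) r)%:R).
pose bad' s u : R := tsum (cnbr Y s) d (fun r => (sparse x (cnbr X u) r)%:R).
(* A pair with [#|A| < x] is charged [x ^+ d >= y ^+ d]. Once [A] is large, [#|B| < x] would make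
   all its at least [x ^+ d] tuples sparse, so [bad] controls [B]. *)
pose tiny u : R := (sparse x X u)%:R * x ^+ d.
have bad0 s u : 0 <= bad s u.
  rewrite -[leLHS](mulr0 (#|cnbr X u|%:R ^+ d)) -tsum_const.
  by apply: ler_tsum => *; rewrite ler0n.
have bad0' s u : 0 <= bad' s u.
  rewrite -[leLHS](mulr0 (#|cnbr Y s|%:R ^+ d)) -tsum_const.
  by apply: ler_tsum => *; rewrite ler0n.
have tiny0 u : 0 <= tiny u by rewrite mulr_ge0 ?ler0n // exprn_ge0 // ltW.
have [|none] := boolp.pselect (exists s u, bad s u + bad' s u + tiny u < y ^+ d).
  move=> [s [u lt_y]].
  have yxd : y ^+ d <= x ^+ d by rewrite lerXn2r ?nnegrE // ltW.
  have xA : x <= #|cnbr X u|%:R.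
    rewrite leNgt; apply/negP => lx; have := bad0 s u; have := bad0' s u.
    move: lt_y; rewrite /tiny /sparse lx mul1r; lra.
  exists (cnbr X u), (cnbr Y s); split => //.
  - by apply/subsetP=> v; rewrite inE => /andP[].
  - by apply/subsetP=> v; rewrite inE => /andP[].
  - rewrite leNgt; apply/negP => lx.
    have : x ^+ d <= bad s u.
      apply: (@le_trans _ _ (#|cnbr X u|%:R ^+ d * 1)).
        by rewrite mulr1 lerXn2r ?nnegrE ?ler0n // ltW.
      rewrite -tsum_const; apply: ler_tsum => r _ _; rewrite /sparse.
      rewrite (le_lt_trans _ lx) // ler_nat subset_leq_card //.
      by apply/subsetP=> v; rewrite inE => /andP[].
    have := bad0' s u; have := tiny0 u; lra.
  - rewrite -/(bad s u) -/(bad' s u).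
    by have := bad0 s u; have := bad0' s u; have := tiny0 u; split; lra.
have hom := bicliques_ge t eps0 cX cY le_e.
have b1 := sparse_tuples_total X Y d t (ltW x0).
have b2 := sparse_tuples_total Y X d t (ltW x0).
have b3 := small_cnbr_total X Y t (ltW x0) (exprn_ge0 d (ltW x0)).
rewrite tsum_exchange in b2.
suff : y ^+ d * (eps ^+ (t * t) * n%:R ^+ (2 * t)) <= 3 * (n%:R ^+ (t + d) * x ^+ t).
  by rewrite leNgt small.
apply: le_trans (ler_wpM2l (exprn_ge0 d (ltW y0)) hom) _.
apply: (@le_trans _ _ (n%:R ^+ (t + d) * x ^+ t + n%:R ^+ (t + d) * x ^+ t +
    n%:R ^+ t * (x ^+ t * x ^+ d))); last first.
  have : n%:R ^+ t * (x ^+ t * x ^+ d) <= n%:R ^+ (t + d) * x ^+ t.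
    rewrite exprD -mulrA ler_wpM2l ?exprn_ge0 ?ler0n // mulrC.
    by rewrite ler_wpM2r ?exprn_ge0 ?(ltW x0) // lerXn2r ?nnegrE ?ler0n // ltW.
  lra.
move: b1 b2 b3; rewrite cX cY => b1 b2 b3.
apply: le_trans (lerD (lerD b1 b2) b3).
rewrite -!tsumD -tsumZ; apply: ler_tsum => s _ _.
rewrite -!tsumD -tsumZ; apply: ler_tsum => u _ _.
rewrite [allrel e u s]allrel_sym; case: allrel; last by rewrite !mul0r mulr0 !addr0.
rewrite !mul1r mulr1 -/(bad s u) -/(bad' s u) -/(tiny u).
by rewrite leNgt; apply/negP => h; apply: none; exists s, u.
Qed.

End RandomChoice.

(** * Extending partial tuples *)

Section Extendable.
Variables (R : realFieldType) (T : finType) (e : rel T) (x y : R).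
Hypothesis y0 : 0 < y.
Implicit Types (X Y : {set T}) (s : seq T).

(* [catrev] makes the case [k.+1] of [s] convertible to the case [k] of [z :: s]. *)
Definition extendable X Y k s : bool :=
  tsum X k (fun r => (sparse e x Y (catrev r s))%:R) < y ^+ k.

(** Averaging over the next entry: at least [y] wrong choices of [z], each with at least [y ^+ k]
    sparse extensions, would give [y ^+ k.+1] in all. *)
Lemma card_not_extendable X Y k s : extendable X Y k.+1 s ->
  #|[set z in X | ~~ extendable X Y k (z :: s)]|%:R < y.
Proof.
rewrite /extendable tsumS => lt_y; rewrite ltNge; apply/negP => le_y.
have := lt_y; rewrite ltNge => /negP; apply.
rewrite exprS; apply: le_trans (ler_wpM2r (exprn_ge0 k (ltW y0)) le_y) _.
rewrite natr_card_sep mulr_suml; apply: ler_sum => z _.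
rewrite -leNgt; case: (leP (y ^+ k)) => [|_]; first by rewrite mul1r.
rewrite mul0r -[leLHS](mulr0 (#|X|%:R ^+ k)) -tsum_const.
by apply: ler_tsum => *; rewrite ler0n.
Qed.

(** Common neighbourhoods shrink under extension: if that of [s] were below [x], all
    [#|X| ^+ k >= y ^+ k] extensions would be sparse. *)
Lemma extendable_cnbr X Y k s : y <= x -> x <= #|X|%:R ->
  extendable X Y k s -> x <= #|cnbr e Y s|%:R.
Proof.
move=> yx xX; rewrite /extendable => ext; rewrite leNgt; apply/negP => lt_x.
have := ext; rewrite ltNge => /negP; apply.
apply: (@le_trans _ _ (#|X|%:R ^+ k * 1)).
  rewrite mulr1 lerXn2r ?nnegrE ?ler0n ?(ltW y0) //.
  exact: le_trans xX.
rewrite -tsum_const; apply: ler_tsum => r _ _; rewrite /sparse.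
rewrite (le_lt_trans _ lt_x) // ler_nat subset_leq_card //.
by apply/subsetP => v; rewrite !inE catrevE all_cat => /and3P[-> _ ->].
Qed.

End Extendable.

(** * Degenerate orders of the vertices *)

Section DegenerateOrder.
Variable H : sgraph.

(* [s] lists the vertices preceding [q]. *)
Fixpoint degenerate_order (d : nat) (s q : seq H) : bool :=
  if q is v :: q' then (count (adj v) s <= d)%N && degenerate_order d (v :: s) q'
  else true.

Lemma degenerate_order_rcons d s q v : degenerate_order d s q ->
  (count (adj v) s + count (adj v) q <= d)%N -> degenerate_order d s (rcons q v).
Proof.
elim: q s => [|w q IH] s /=; first by rewrite addn0 andbT.
by move=> /andP[-> ow] cv /=; apply: IH => //=; rewrite -addnA addnCA.
Qed.

Lemma degenerate_order_count d s q w :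
  degenerate_order d s q -> w \in q -> (count (adj w) s <= d)%N.
Proof.
elim: q s => [|v q IH] s //= /andP[cv oq]; rewrite inE => /orP[/eqP->//|wq].
by apply: leq_trans (IH _ oq wq); rewrite leq_addl.
Qed.

(** Built from the end: a vertex of degree at most [d] in the subgraph induced on [S] goes last, and
    induction orders the rest. *)
Lemma degenerate_orderP d : degenerate d H ->
  exists q : seq H, [/\ uniq q, (forall v, v \in q) & degenerate_order d [::] q].
Proof.
move=> dH.
suff main (S : {set H}) :
    exists q : seq H, [/\ uniq q, q =i S & degenerate_order d [::] q].
  by have [q [uq qS oq]] := main [set: H]; exists q; split=> // v; rewrite qS inE.
have [m] := ubnP #|S|; elim: m S => // m IH S cS.
have [->|Sn0] := eqVneq S set0.
  by exists [::]; split=> // v; rewrite inE.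
pose e u v := [&& u \in S, v \in S & adj u v].
have [] := dH S e _ Sn0.
  split=> [u v|u v /and3P[]//].
  by rewrite /e adj_sym; case: (u \in S); case: (v \in S).
move=> v vS cv.
have [|q [uq qS oq]] := IH (S :\ v).
  by move: cS; rewrite (cardsD1 v S) vS ltnS.
exists (rcons q v); split.
- by rewrite rcons_uniq uq qS !inE eqxx.
- move=> u; rewrite mem_rcons inE qS !inE.
  by have [->|] := eqVneq u v; rewrite ?vS.
- apply: degenerate_order_rcons => //=; rewrite add0n -size_filter.
  apply: leq_trans cv; rewrite -(card_uniqP (filter_uniq _ uq)).
  apply: subset_leq_card; apply/subsetP=> u.
  by rewrite mem_filter qS !inE /e vS => /andP[-> /andP[_ ->]].
Qed.

End DegenerateOrder.

(** * Greedy embedding *)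

Section Embedding.
Variables (R : realFieldType) (H G : sgraph) (c : H -> bool) (P : bool -> {set G}).
Variables (x y : R) (d Delta : nat).
Hypothesis cP : forall u v : H, adj u v -> c v = ~~ c u.
Hypothesis card_P : forall b, x <= #|P b|%:R.
Hypothesis y0 : 0 < y.
Hypothesis yx : y <= x.
Hypothesis xH : 4 * #|H|%:R <= x.
Hypothesis degH : forall v : H, (degree v <= Delta)%N.
Hypothesis yDelta : 4 * (Delta%:R * y) <= x.

Let images (f : H -> G) (w : H) (s : seq H) : seq G :=
  [seq f u | u <- s & adj w u].

(* The neighbours of [w] are embedded in [P (~~ c w)], and [w] in [P (c w)]. *)
Let open_for (f : H -> G) (s : seq H) (w : H) : bool :=
  extendable (@adj G) x y (P (~~ c w)) (P (c w)) (d - count (adj w) s)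
    (images f w s).

(** Of at least [x] common neighbours, the used vertices remove at most [x / 4], and the at most
    [Delta] later neighbours of [v] together at most [Delta * y <= x / 4]. *)
Lemma card_choices (f : H -> G) (s q : seq H) (v : H) :
  uniq (v :: s) -> degenerate_order d s (v :: q) ->
  (forall w, w \in v :: q -> open_for f s w) ->
  x / 4 <= #|[set z in cnbr (@adj G) (P (c v)) (images f v s) |
     (z \notin map f s) &&
     all (fun w => adj v w ==> extendable (@adj G) x y (P (~~ c w)) (P (c w))
             (d - count (adj w) (v :: s)) (z :: images f w s)) q]|%:R.
Proof.
move=> us oq of_; set C := cnbr _ _ _; set Z := [set z in C | _].
have xC : x <= #|C|%:R.
  by apply: extendable_cnbr (of_ v (mem_head _ _)).
pose E w := [set z in P (c v) | ~~ extendable (@adj G) x y (P (c v)) (P (~~ c v))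
     (d - count (adj w) (v :: s)) (z :: images f w s)].
pose W := [set w in q | adj v w].
have cE w : w \in W -> #|E w|%:R < y.
  rewrite inE => /andP[wq vw].
  have wc := cP vw; have := of_ w; rewrite inE wq orbT => /(_ isT).
  rewrite /open_for wc negbK => ext; apply: card_not_extendable => //.
  (* The order gives [count (adj w) (v :: s) <= d], so the truncated [d - count (adj w) s] is a
     genuine successor. *)
  rewrite /= adj_sym vw add1n subnSK //.
  have /andP[_ oq'] := oq.
  by have := degenerate_order_count oq' wq; rewrite /= adj_sym vw add1n.
have sub : C \subset Z :|: [set z in map f s] :|: \bigcup_(w in W) E w.
  apply/subsetP=> z zC; rewrite 2!in_setU.
  have [zs|zs] := boolP (z \in map f s);
    first by rewrite [in X in _ || X || _]inE zs orbT.
  have [zZ|] := boolP (z \in Z); first by [].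
  rewrite /Z in_set zC zs /= => /allPn[w wq]; rewrite negb_imply => /andP[vw nz].
  apply/orP; right.
  apply/bigcupP; exists w; rewrite inE ?wq //.
  by move: zC; rewrite !inE => /andP[-> _]; move: nz; rewrite (cP vw) negbK.
have cW : (#|W| <= Delta)%N.
  apply: leq_trans (degH v); apply: subset_leq_card.
  by apply/subsetP=> w; rewrite !inE => /andP[].
have cU : #|\bigcup_(w in W) E w|%:R <= Delta%:R * y.
  apply: (@le_trans _ _ (\sum_(w in W) #|E w|)%:R).
    rewrite ler_nat; elim/big_rec2: _ => [|w A k _ IH]; first by rewrite cards0.
    by apply: leq_trans (leq_card_setU _ _) _; rewrite leq_add2l.
  rewrite natr_sum; apply: (@le_trans _ _ (\sum_(w in W) y)).
    by apply: ler_sum => w wW; apply/ltW/cE.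
  by rewrite sumr_const -[leLHS]mulr_natl ler_wpM2r ?(ltW y0) // ler_nat.
have cs : (#|[set z in map f s]| <= #|H|)%N.
  rewrite cardsE; apply: leq_trans (card_size _) _.
  rewrite size_map; have /andP[_ /card_uniqP <-] := us; exact: max_card.
have tot : (#|C| <= #|Z| + #|[set z in map f s]| + #|\bigcup_(w in W) E w|)%N.
  apply: leq_trans (subset_leq_card sub) _.
  apply: leq_trans (leq_card_setU _ _) _; rewrite leq_add2r.
  exact: leq_card_setU.
have {}tot : #|C|%:R <= #|Z|%:R + #|H|%:R + #|\bigcup_(w in W) E w|%:R :> R.
  by rewrite -!natrD ler_nat (leq_trans tot) // leq_add2r leq_add2l.
have x0 := lt_le_trans y0 yx.
have lin (C' Z' H' U' D : R) : x <= C' -> 4 * H' <= x -> 4 * D <= x -> U' <= D ->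
  C' <= Z' + H' + U' -> x / 4 <= Z' by lra.
exact: lin xC xH yDelta cU tot.
Qed.

(** Only the values of [f] on [s] matter. The next vertex [v] has at least [x / 4] images, and
    copies with different [g v] are distinct, so the inductive counts add up. *)
Lemma card_extensions (q s : seq H) (f : H -> G) :
  uniq (s ++ q) -> (forall u, u \in s ++ q) -> degenerate_order d s q ->
  {in s &, injective f} -> {in s &, forall u v, adj u v -> adj (f u) (f v)} ->
  (forall w, w \in q -> open_for f s w) ->
  (x / 4) ^+ size q <=
    #|[set g in labeled_copies H G | all (fun u => g u == f u) s]|%:R.
Proof.
elim: q s f => [|v q IH] s f.
  rewrite cats0 => us allH _ uf fadj _.
  rewrite expr0 ler1n card_gt0; apply/set0Pn; exists [ffun u => f u].
  rewrite !inE; apply/andP; split; last by apply/allP=> u _; rewrite ffunE.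
  apply/andP; split.
    apply/injectiveP => u w; rewrite !ffunE => fuw.
    exact: uf.
  apply/forallP=> u; apply/forallP=> w; apply/implyP=> uw; rewrite !ffunE.
  exact: fadj.
move=> us allH oq uf fadj of_.
have vs : v \notin s.
  by move: us; rewrite cat_uniq /= negb_or => /and3P[_ /andP[]].
have uvs : uniq (v :: s).
  by move: us; rewrite /= vs cat_uniq => /and3P[].
have := card_choices uvs oq of_; set Z := [set z in _ | _] => cZ.
pose upd z u := if u == v then z else f u.
have updE z u : u \in s -> upd z u = f u.
  by rewrite /upd; case: eqP => // ->; rewrite (negPf vs).
have step z : z \in Z -> (x / 4) ^+ size q <=
    #|[set g in labeled_copies H G | all (fun u => g u == upd z u) (v :: s)]|%:R.
  rewrite !inE => /andP[/andP[_ zadj] /andP[zs zext]].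
  have img w : images (upd z) w s = images f w s.
    by apply/eq_in_map => u; rewrite mem_filter => /andP[_ /updE].
  have fz u : u \in s -> adj v u -> adj z (f u).
    move=> us' vu; apply: (allP zadj); apply/mapP; exists u => //.
    by rewrite mem_filter vu.
  have updv : upd z v = z by rewrite /upd eqxx.
  have perm : perm_eq ((v :: s) ++ q) (s ++ v :: q).
    by rewrite perm_sym -[v :: q]cat1s perm_catCA.
  apply: IH.
  - by rewrite (perm_uniq perm).
  - by move=> u; rewrite (perm_mem perm).
  - by have /andP[] := oq.
  - move=> u w; rewrite !inE => /orP[/eqP->|us'] /orP[/eqP->|ws] //.
    + by rewrite updv updE // => zw; rewrite zw map_f in zs.
    + by rewrite updv updE // => zu; rewrite -zu map_f in zs.
    + by rewrite !updE //; apply: uf.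
  - move=> u w; rewrite !inE => /orP[/eqP->|us'] /orP[/eqP->|ws] auw.
    + by rewrite adj_irr in auw.
    + by rewrite updv updE // fz.
    + by rewrite updv updE // adj_sym fz // adj_sym.
    + by rewrite !updE //; apply: fadj.
  (* A later neighbour of [v] stays open by the choice of [z]; for other [w] neither images nor
     count change. *)
  - move=> w wq; rewrite /open_for /images /=; have := allP zext w wq.
    rewrite /= adj_sym; case: (adj w v) => /=.
      by rewrite updv -/(images (upd z) w s) img.
    by rewrite add0n -/(images (upd z) w s) img => _; apply: of_; rewrite inE wq orbT.
have x4 : 0 <= x / 4 by rewrite divr_ge0 // (le_trans (ltW y0)).
rewrite /= exprS; apply: le_trans (ler_wpM2r (exprn_ge0 _ x4) cZ) _.
set S := [set g in _ | _].
have -> : #|S|%:R = \sum_z #|[set g in S | g v == z]|%:R :> R.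
  rewrite -natr_sum -sum1_card (partition_big (fun g : {ffun H -> G} => g v) xpredT) //.
  congr (_%:R); apply: eq_bigr => z _; rewrite -sum1_card.
  by apply: eq_bigl => g; rewrite !inE.
rewrite mulr_natl -sumr_const (bigID (mem Z) xpredT) /= ler_wpDr ?sumr_ge0 //.
apply: ler_sum => z zZ; apply: le_trans (step z zZ) _.
rewrite ler_nat; apply: subset_leq_card; apply/subsetP => g.
rewrite !inE /= {1}/upd eqxx => /and3P[-> -> gs]; rewrite andbT.
by apply/allP => u us'; rewrite -(updE z) ?(allP gs).
Qed.

End Embedding.

(** * Edges counted from one part *)

Lemma card_edges_le (G : sgraph) (V1 V2 : {set G}) : bipartition V1 V2 ->
  (#|edges G| <= \sum_(v in V2) #|cnbr (@adj G) V1 [:: v]|)%N.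
Proof.
move=> [_ _ bip].
pose D := [set p : G * G | (p.1 \in V2) && (p.2 \in cnbr (@adj G) V1 [:: p.1])].
have -> : \sum_(v in V2) #|cnbr (@adj G) V1 [:: v]| = #|D|.
  under eq_bigr do rewrite -sum1_card.
  by rewrite pair_big_dep -sum1_card; apply: eq_bigl => p; rewrite !inE.
(* Each edge is the image of the pair in [D] that starts at its end in [V2]. *)
apply: leq_trans (leq_imset_card (fun p : G * G => [set p.1; p.2]) D).
apply: subset_leq_card; apply/subsetP => A; rewrite inE.
move=> /existsP[u /existsP[v /andP[uv /eqP->]]]; apply/imsetP.
have [[u1 v2]|[u2 v1]] := bip u v uv.
  by exists (v, u); rewrite ?inE /= ?u1 ?v2 ?uv // setUC.
by exists (u, v); rewrite ?inE /= ?u2 ?v1 ?(adj_sym v) ?uv.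
Qed.

(** * The exponents in [x] *)

Section Exponents.
Variables (R : realType) (eps delta : R) (d k Delta : nat).
Hypotheses (eps0 : 0 < eps) (eps1 : eps <= 1) (delta0 : 0 < delta).
Hypotheses (Delta0 : (0 < Delta)%N).

(** This is the ratio of [x] to [N]. *)
Let r : R := 2 ^- 9 * eps `^ ((1 + (1 + delta^-1) * d%:R) * (1 + delta))
               * Delta%:R `^ (- delta).

Let Delta1 : 1 <= Delta%:R :> R. Proof. by rewrite ler1n. Qed.

Lemma ratio_gt0 : 0 < r.
Proof. by rewrite /r !mulr_gt0 ?powR_gt0 ?ltr0n ?invr_gt0 ?exprn_gt0. Qed.

Lemma ratio_le1 : r <= 1.
Proof.
have e1 : eps `^ ((1 + (1 + delta^-1) * d%:R) * (1 + delta)) <= 1.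
  rewrite -[leRHS](powRr0 eps); apply: ger_powR; first by rewrite eps0.
  have delta0' : 0 < delta^-1 by rewrite invr_gt0.
  apply: mulr_ge0; last by rewrite addr_ge0 // ltW.
  by rewrite addr_ge0 // mulr_ge0 // addr_ge0 // ltW.
have D1 : Delta%:R `^ (- delta) <= 1 :> R.
  by rewrite -[leRHS](powRr0 Delta%:R); apply: ler_powR; rewrite // oppr_le0 ltW.
rewrite /r mulr_ile1 ?mulr_ge0 ?powR_ge0 ?invr_ge0 ?exprn_ge0 //.
rewrite mulr_ile1 ?powR_ge0 ?invr_ge0 ?exprn_ge0 //.
by rewrite invf_le1 ?exprn_gt0 // exprn_ege1 // ler1n.
Qed.

(** This is the inequality required by the random choice for [t = d + k], common factors cancelled.
    Powers of [eps], powers of [Delta] and constants are compared separately. *)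
Lemma ratio_exp_lt : (0 < d)%N -> delta <= 1 ->
  d%:R / delta <= k%:R -> k%:R <= d%:R / delta + 1 ->
  3 * r ^+ k < (128 * Delta%:R) ^- d * eps ^+ ((d + k) * (d + k)).
Proof.
move=> d0 delta1 dk kd.
have dk' : d%:R <= k%:R * delta by rewrite -ler_pdivrMr.
have led : (d <= k)%N.
  rewrite -(ler_nat R); apply: le_trans dk' _.
  by rewrite ler_piMr.
(* The upper bound on [k] gives [d + k <= 1 + (1 + delta^-1) * d], the lower one
   [d + k <= (1 + delta) * k]. *)
have eE : (eps `^ ((1 + (1 + delta^-1) * d%:R) * (1 + delta))) ^+ k <=
    eps ^+ ((d + k) * (d + k)).
  rewrite -!powR_mulrn ?powR_ge0 ?(ltW eps0) // -powRrM.
  apply: ger_powR; first by rewrite eps0.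
  rewrite natrM -mulrA ler_pM ?ler0n //.
    by rewrite natrD; move: kd; lra.
  by rewrite natrD; move: dk'; lra.
have DE : (Delta%:R `^ (- delta)) ^+ k <= Delta%:R ^- d :> R.
  rewrite -powR_mulrn ?powR_ge0 // -powRrM -powR_invn //.
  by apply: ler_powR => //; move: dk'; lra.
have cE : 3 * (2 ^- 9) ^+ k < 128 ^- d :> R.
  apply: (@le_lt_trans _ _ (3 * (2 ^- 9) ^+ d)).
    rewrite ler_wpM2l // ler_wiXn2l ?invr_ge0 ?exprn_ge0 //.
    by rewrite invf_le1 ?exprn_gt0 // exprn_ege1 // ler1n.
  (* The factor [128^-1] matches the right side; the spare [4^-1], to the power [d >= 1], absorbs
     the 3. *)
  have -> : 2 ^- 9 = 4^-1 * 128^-1 :> R by field.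
  rewrite exprMn -!exprVn mulrA gtr_pMl ?exprn_gt0 ?invr_gt0 //.
  rewrite -(prednK d0) exprS mulrA.
  apply: (@le_lt_trans _ _ (3 * 4^-1)); last by lra.
  by rewrite ler_piMr ?exprn_ile1 ?invr_ge0 //; lra.
rewrite /r; set E := eps `^ _; set D := Delta%:R `^ _.
have -> : 3 * (2 ^- 9 * E * D) ^+ k = 3 * (2 ^- 9) ^+ k * (E ^+ k * D ^+ k).
  by rewrite !(exprMn k) !mulrA.
rewrite exprMn [(128 ^+ d * _)^-1]invfM -[ltRHS]mulrA [Delta%:R ^- d * _]mulrC.
apply: (@lt_le_trans _ _ (128 ^- d * (E ^+ k * D ^+ k))).
  by rewrite ltr_pM2r // mulr_gt0 ?exprn_gt0 ?powR_gt0 ?ltr0n.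
by rewrite ler_wpM2l ?invr_ge0 ?exprn_ge0 // ler_pM ?exprn_ge0 ?powR_ge0.
Qed.

End Exponents.

(** * Counting the copies of [H] *)

Lemma cnbr_rev (T : finType) (e : rel T) (Y : {set T}) s :
  cnbr e Y (rev s) = cnbr e Y s.
Proof. by apply/setP => v; rewrite !inE all_rev. Qed.

Lemma embedding_count (R : realFieldType) (H G : sgraph) (A B : {set G}) (x y : R)
    (d Delta : nat) :
  bipartite H -> degenerate d H -> (max_degree H <= Delta)%N ->
  0 < y -> y <= x -> 4 * #|H|%:R <= x -> 4 * (Delta%:R * y) <= x ->
  x <= #|A|%:R -> x <= #|B|%:R ->
  tsum A d (fun r => (sparse (@adj G) x B r)%:R) < y ^+ d ->
  tsum B d (fun r => (sparse (@adj G) x A r)%:R) < y ^+ d ->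
  (x / 4) ^+ #|H| <= #|labeled_copies H G|%:R.
Proof.
move=> [W1 [W2 [_ dis bip]]] dH mH y0 yx xH yD xA xB sA sB.
(* A default value for the map that starts the induction, where no vertex is embedded yet. *)
have [a0 _] : exists a, a \in A.
  apply/set0Pn; rewrite -card_gt0 -(ltr0n R).
  exact: lt_le_trans y0 (le_trans yx xA).
have [q [uq allq oq]] := degenerate_orderP dH.
pose c (u : H) := u \in W1.
pose P b := if b then A else B.
have cP (u v : H) : adj u v -> c v = ~~ c u.
  by move=> /bip [[u1 v2]|[u2 v1]]; rewrite /c ?u1 ?v1 ?(disjointFl dis).
have card_P b : x <= #|P b|%:R by case: b.
have degH (v : H) : (degree v <= Delta)%N.
  exact: leq_trans (leq_bigmax v) mH.
have szq : size q = #|H| by rewrite -(card_uniqP uq); apply: eq_card => v; rewrite allq.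
have := card_extensions (d := d) cP card_P y0 yx xH degH yD
  (q := q) (s := [::]) (f := fun=> a0) uq allq oq.
rewrite szq => ext; apply: le_trans (ext _ _ _) _ => //.
  (* With nothing embedded, being open is one of the two bounds on sparse [d]-tuples, up to
     reversing the tuples. *)
  move=> w _; rewrite /= subn0 /extendable.
  under eq_tsum => r do rewrite /sparse -/(rev r) cnbr_rev.
  by rewrite /P; case: (c w).
rewrite ler_nat subset_leq_card //.
by apply/subsetP => g; rewrite inE => /andP[].
Qed.

Unset Implicit Arguments.

Theorem theorem3p1 (R : realType) (H G : sgraph) (d n Delta N : nat)
    (V1 V2 : {set G}) (eps delta : R) :
  bipartite H -> degenerate d H -> #|H| = n -> max_degree H = Delta ->
  0 < eps ->
  bipartition V1 V2 -> #|V1| = N -> #|V2| = N ->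
  eps * N%:R ^+ 2 <= #|edges G|%:R ->
  (2 <= d)%N -> d%:R / n%:R <= delta -> delta <= 1 ->
  let x : R := 2 ^- 9
    * eps `^ ((1 + (1 + delta^-1) * d%:R) * (1 + delta))
    * Delta%:R `^ (- delta) * N%:R in
  4 * n%:R <= x ->
  (x / 4) ^+ n <= #|labeled_copies H G|%:R.
Proof.
move=> bH dH cH mH eps0 bG cV1 cV2 eE d2 dn delta1 x xn.
(* For [n = 0] the quotient [d / n] is 0 by convention and does not force [delta > 0]; the empty map
   is a copy. *)
have [n0|n0] := posnP n.
  rewrite n0 expr0 ler1n card_gt0; rewrite n0 in cH.
  have noH (h : H) : False by have := fintype0 h; rewrite cH.
  apply/set0Pn; exists (ffun0 cH); rewrite inE; apply/andP; split.
    by apply/injectiveP => h; case: (noH h).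
  by apply/forallP => h; case: (noH h).
have d0 : (0 < d)%N by apply: leq_trans d2.
have delta0 : 0 < delta by apply: lt_le_trans dn; rewrite divr_gt0 ?ltr0n.
have x0 : 0 < x by apply: lt_le_trans xn; rewrite mulr_gt0 ?ltr0n.
(* By convention 0 to a nonzero power is 0, so [Delta = 0] would give [x = 0]. *)
have Delta0 : (0 < Delta)%N.
  rewrite lt0n; apply/negP => /eqP D0; move: x0.
  by rewrite /x D0 powR0 ?oppr_eq0 ?gt_eqF // mulr0 mul0r ltxx.
have N0 : (0 < N)%N.
  by rewrite lt0n; apply/negP => /eqP N0; move: x0; rewrite /x N0 mulr0 ltxx.
have {}eE : eps * N%:R ^+ 2 <= \sum_(v in V2) #|cnbr (@adj G) V1 [:: v]|%:R.
  by apply: le_trans eE _; rewrite -natr_sum ler_nat card_edges_le.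
have eps1 : eps <= 1.
  rewrite -(ler_pM2r (_ : 0 < N%:R ^+ 2)) ?exprn_gt0 ?ltr0n // mul1r.
  apply: le_trans eE _; rewrite expr2 -{1}cV2 mulr_natl -sumr_const.
  apply: ler_sum => v _; rewrite ler_nat -cV1 subset_leq_card //.
  by apply/subsetP => u; rewrite inE => /andP[].
(* The least integer exceeding [d / delta]. *)
pose k := (Num.trunc (d%:R / delta)).+1.
have dd0 : 0 <= d%:R / delta by rewrite divr_ge0 // ltW.
have dk : d%:R / delta <= k%:R by rewrite ltW // truncnS_gt.
have kd : k%:R <= d%:R / delta + 1 by rewrite -natr1 lerD2r truncn_le.
have r0 := ratio_gt0 delta d eps0 Delta0.
have r1 := ratio_le1 d eps0 eps1 delta0 Delta0.
have rk := ratio_exp_lt eps0 eps1 delta0 Delta0 d0 delta1 dk kd.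
move: r0 r1 rk @x xn x0; set r := _ * _ => r0 r1 rk x xn x0.
have D1 : 1 <= Delta%:R :> R by rewrite ler1n.
(* Here 128 is [2 ^ 9 / 4], as in the comparison of constants; the embedding asks for
   [4 * Delta * y <= x]. *)
pose y := x / (128 * Delta%:R).
have y0 : 0 < y by rewrite divr_gt0 // mulr_gt0 ?ltr0n.
have yx : y <= x.
  by rewrite ler_pdivrMr ?mulr_gt0 ?ltr0n // ler_peMr ?(ltW x0) //; lra.
have xN : x <= N%:R by rewrite /x ler_piMl.
(* Both sides share the factor [r ^+ d * N ^+ (2 * (d + k) + d)]. *)
have small : 3 * (N%:R ^+ ((d + k) + d) * x ^+ (d + k)) <
    y ^+ d * (eps ^+ ((d + k) * (d + k)) * N%:R ^+ (2 * (d + k))).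
  have c0 : 0 < r ^+ d * N%:R ^+ (2 * (d + k) + d).
    by rewrite mulr_gt0 ?exprn_gt0 ?ltr0n.
  have -> : 3 * (N%:R ^+ ((d + k) + d) * x ^+ (d + k)) =
      3 * r ^+ k * (r ^+ d * N%:R ^+ (2 * (d + k) + d)).
    rewrite /x (exprMn (d + k)) mul2n -addnn !exprD; ring.
  have -> : y ^+ d * (eps ^+ ((d + k) * (d + k)) * N%:R ^+ (2 * (d + k))) =
      (128 * Delta%:R) ^- d * eps ^+ ((d + k) * (d + k)) *
      (r ^+ d * N%:R ^+ (2 * (d + k) + d)).
    rewrite /y /x 2!(exprMn d) exprVn [N%:R ^+ (2 * (d + k) + d)]exprD; ring.
  by rewrite ltr_pM2r.
have [A [B [AV1 BV2 xA xB [sA sB]]]] :=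
  dependent_random_choice (@adj_sym G) (ltW eps0) x0 xN y0 yx cV1 cV2 eE small.
rewrite -cH; apply: (embedding_count (Delta := Delta) bH dH _ y0 yx _ _ xA xB sA sB).
- by rewrite mH.
- by rewrite cH.
- have -> : Delta%:R * y = x / 128 by rewrite /y; field; rewrite pnatr_eq0 -lt0n.
  lra.
Qed.
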